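(* Let $m=4+12q$ with $q=1+2d$ for a nonnegative integer $d$. The minimal decomposition of $\mathbb{Z}_2$ for the Fibonacci polynomial $F_m$ is $$\mathbb{Z}_2=\{0\}\sqcup\Bigl(\bigcup_{k=0}^{3}M_k\Bigr)\sqcup(2\mathbb{Z}_2-\{0\}),$$ where $M_k=(1+4k+2^4\mathbb{Z}_2)\cup(11+4k+2^4\mathbb{Z}_2)$. Here $\{0\}$ is the set of a fixed point, the $M_k$'s are the minimal components, and the set $2\mathbb{Z}_2-\{0\}$ is the attracting basin of the fixed point $0$.
   Context: $\mathbb{Z}_2$ is the ring of 2-adic integers with the 2-adic metric. The Fibonacci polynomials are defined by $F_0(x)=0$, $F_1(x)=1$, $F_m(x)=xF_{m-1}(x)+F_{m-2}(x)$ for $m\ge 2$. For a polynomial $f$ over $\mathbb{Z}_2$, a minimal decomposition of $\mathbb{Z}_2$ for $f$ is a decomposition $\mathbb{Z}_2=\mathcal P\sqcup\mathcal M\sqcup\mathcal B$ (some parts possibly empty) in which: $\mathcal P$ is the finite set consisting of all periodic points of $f$; $\mathcal M=\bigsqcup_i\mathcal M_i$ is the union of all (at most countably many) clopen $f$-invariant sets $\mathcal M_i$ (the minimal components), each a finite union of balls, such that each $f:\mathcal M_i\to\mathcal M_i$ is minimal (every orbit is dense in $\mathcal M_i$); and each point of $\mathcal B$ lies in the attracting basin of a periodic orbit or of a minimal subsystem. A point $x$ lies in the attracting basin of a set $C$ (a periodic orbit or minimal component) if the distance from $f^n(x)$ to $C$ tends to $0$ as $n\to\infty$; when a part $\mathcal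 B$ of a decomposition is said to be the attracting basin of $C$, this means every point of $\mathcal B$ lies in the attracting basin of $C$ (the points of $C$ being listed separately). *)

(* Defs.v *)
From HB Require Import structures.
From mathcomp Require Import all_boot all_order all_algebra.
From mathcomp Require Import all_classical all_reals all_analysis.

Set Implicit Arguments.
Unset Strict Implicit.
Unset Printing Implicit Defensive.

Import Order.TTheory GRing.Theory Num.Theory.

(* The 2-adic integers as the inverse limit of the rings Z/2^n: [res x n] is   *)
(* the representative in [0, 2^n[ of x modulo 2^n.  Coherence at n forces the  *)
(* bound, since res x n is a remainder modulo 2^n.                             *)
Record Z2 := MkZ2 {
  res : nat -> nat;
  res_coh : forall n, res n.+1 %% 2 ^ n = res n
}.

HB.instance Definition _ := gen_eqMixin Z2.
HB.instance Definition _ := gen_choiceMixin Z2.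

Lemma Z2_eq (x y : Z2) : (forall n, res x n = res y n) -> x = y.
Proof.
case: x y => [x hx] [y hy] /= /funext exy; case: _ / exy in hy *.
by congr MkZ2; exact: Prop_irrelevance.
Qed.

Lemma res_mod (x : Z2) n : res x n %% 2 ^ n = res x n.
Proof. by rewrite -{1}res_coh modn_mod res_coh. Qed.

Lemma res_lt (x : Z2) n : res x n < 2 ^ n.
Proof. by rewrite -res_mod ltn_mod expn_gt0. Qed.

Lemma res_le (x : Z2) m n : m <= n -> res x n %% 2 ^ m = res x m.
Proof.
elim: n => [|n IHn]; first by rewrite leqn0 => /eqP->; rewrite res_mod.
rewrite leq_eqVlt => /predU1P[->|]; first by rewrite res_mod.
rewrite ltnS => lemn; rewrite -(IHn lemn) -(res_coh x n) modn_dvdm //.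
exact: dvdn_exp2l.
Qed.

Section ResidueRing.

Let dvdS n : 2 ^ n %| 2 ^ n.+1. Proof. exact: dvdn_exp2l. Qed.

Fact nat_coh k n : (k %% 2 ^ n.+1) %% 2 ^ n = k %% 2 ^ n.
Proof. exact: modn_dvdm. Qed.

Definition Z2_nat k := MkZ2 (nat_coh k).

Fact add_coh (x y : Z2) n :
  ((res x n.+1 + res y n.+1) %% 2 ^ n.+1) %% 2 ^ n = (res x n + res y n) %% 2 ^ n.
Proof. by rewrite modn_dvdm // -modnDm !res_coh. Qed.

Definition Z2_add x y := MkZ2 (add_coh x y).

Fact mul_coh (x y : Z2) n :
  ((res x n.+1 * res y n.+1) %% 2 ^ n.+1) %% 2 ^ n = (res x n * res y n) %% 2 ^ n.
Proof. by rewrite modn_dvdm // -modnMm !res_coh. Qed.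

Definition Z2_mul x y := MkZ2 (mul_coh x y).

Fact opp_coh (x : Z2) n :
  ((2 ^ n.+1 - res x n.+1) %% 2 ^ n.+1) %% 2 ^ n = (2 ^ n - res x n) %% 2 ^ n.
Proof.
rewrite modn_dvdm //; apply/eqP; rewrite -(eqn_modDr (res x n.+1)).
rewrite subnK; last exact/ltnW/res_lt.
rewrite -[X in _ == X]modnDmr res_coh subnK; last exact/ltnW/res_lt.
by rewrite modnn -/(2 ^ n.+1 %% 2 ^ n == 0) (eqP (dvdS n)).
Qed.

Definition Z2_opp x := MkZ2 (opp_coh x).

Fact Z2_addA : associative Z2_add.
Proof. by move=> x y z; apply: Z2_eq => n /=; rewrite modnDml modnDmr addnA. Qed.

Fact Z2_addC : commutative Z2_add.
Proof. by move=> x y; apply: Z2_eq => n /=; rewrite addnC. Qed.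

Fact Z2_add0 : left_id (Z2_nat 0) Z2_add.
Proof. by move=> x; apply: Z2_eq => n /=; rewrite mod0n add0n res_mod. Qed.

Fact Z2_addN : left_inverse (Z2_nat 0) Z2_opp Z2_add.
Proof.
move=> x; apply: Z2_eq => n /=; rewrite modnDml subnK ?modnn ?mod0n //.
exact/ltnW/res_lt.
Qed.

Fact Z2_mulA : associative Z2_mul.
Proof. by move=> x y z; apply: Z2_eq => n /=; rewrite modnMml modnMmr mulnA. Qed.

Fact Z2_mulC : commutative Z2_mul.
Proof. by move=> x y; apply: Z2_eq => n /=; rewrite mulnC. Qed.

Fact Z2_mul1 : left_id (Z2_nat 1) Z2_mul.
Proof. by move=> x; apply: Z2_eq => n /=; rewrite modnMml mul1n res_mod. Qed.

Fact Z2_mulD : left_distributive Z2_mul Z2_add.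
Proof. by move=> x y z; apply: Z2_eq => n /=; rewrite modnMml modnDm mulnDl. Qed.

Fact Z2_1neq0 : Z2_nat 1 != Z2_nat 0.
Proof. by apply/eqP => /(congr1 (fun x => res x 1)). Qed.

End ResidueRing.

HB.instance Definition _ :=
  GRing.isZmodule.Build Z2 Z2_addA Z2_addC Z2_add0 Z2_addN.
HB.instance Definition _ :=
  GRing.Zmodule_isComNzRing.Build Z2 Z2_mulA Z2_mulC Z2_mul1 Z2_mulD Z2_1neq0.

Lemma res0 n : res 0%R n = 0. Proof. exact: mod0n. Qed.

Lemma resD (x y : Z2) n : res (x + y)%R n = (res x n + res y n) %% 2 ^ n.
Proof. by []. Qed.

Lemma resN (x : Z2) n : res (- x)%R n = (2 ^ n - res x n) %% 2 ^ n.
Proof. by []. Qed.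

Lemma resM (x y : Z2) n : res (x * y)%R n = (res x n * res y n) %% 2 ^ n.
Proof. by []. Qed.

Lemma res_natr k n : res (k%:R)%R n = k %% 2 ^ n.
Proof.
elim: k => [|k IHk]; first by rewrite mulr0n res0 mod0n.
by rewrite mulrS resD IHk /= modnDm add1n.
Qed.

Lemma resB_eq0 (x y : Z2) n : (res (x - y)%R n == 0) = (res x n == res y n).
Proof.
rewrite resD resN modnDmr -[X in _ == X](mod0n (2 ^ n)).
rewrite -(eqn_modDr (res y n)) -addnA.
rewrite subnK; last exact/ltnW/res_lt.
by rewrite add0n modnDr !res_mod.
Qed.

Local Open Scope classical_set_scope.
Local Open Scope ring_scope.

(* 2-adic valuation; the value at 0 is immaterial *)
Definition val2 (x : Z2) : nat :=
  xget 0%N [set n | res x n = 0%N /\ res x n.+1 <> 0%N].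

Definition norm2 (R : realType) (x : Z2) : R :=
  if x == 0 then 0 else 2 ^- val2 x.

Lemma val2P (x : Z2) : x != 0 -> res x (val2 x) = 0%N /\ res x (val2 x).+1 <> 0%N.
Proof.
move=> x0; rewrite /val2; case: xgetP => [n _ //|noval].
case/eqP: x0; apply: Z2_eq => n; rewrite res0; elim: n => [|n IHn].
  by have := res_lt x 0; rewrite expn0 ltnS leqn0 => /eqP.
by apply: contrapT => /(conj IHn) /noval.
Qed.

Lemma norm2_le (R : realType) (x : Z2) n :
  (norm2 R x <= 2 ^- n) = (res x n == 0%N).
Proof.
rewrite /norm2; case: eqVneq => [->|/val2P[v0 v1]].
  by rewrite res0 eqxx invr_ge0 exprn_ge0.
rewrite lef_pV2 ?posrE ?exprn_gt0 // ler_eXn2l ?ltr1n //.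
case: leqP => [lenv|ltvn].
  by rewrite -(res_le x lenv) v0 mod0n eqxx.
by apply/esym/eqP => xn0; apply: v1; rewrite -(res_le x ltvn) xn0 mod0n.
Qed.

Section Metric.
Variable R : realType.

Definition dist2 (x y : Z2) : R := norm2 R (x - y).

Lemma dist2_le x y n : (dist2 x y <= 2 ^- n) = (res x n == res y n).
Proof. by rewrite /dist2 norm2_le resB_eq0. Qed.

Lemma norm2_ge0 x : 0 <= norm2 R x.
Proof. by rewrite /norm2; case: ifP => // _; rewrite invr_ge0 exprn_ge0. Qed.

Lemma dist2xx x : dist2 x x = 0.
Proof. by rewrite /dist2 subrr /norm2 eqxx. Qed.

Lemma dist2_eq0 x y : dist2 x y = 0 -> x = y.
Proof.
move=> xy0; apply: Z2_eq => n; apply/eqP.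
by rewrite -dist2_le xy0 invr_ge0 exprn_ge0.
Qed.

Lemma dist2_val x y : dist2 x y = 0 \/ exists n, dist2 x y = 2 ^- n.
Proof. by rewrite /dist2 /norm2; case: ifP => _; [left|right; exists (val2 (x - y))]. Qed.

Lemma dist2C x y : dist2 x y = dist2 y x.
Proof.
suff le u v : dist2 u v <= dist2 v u by apply/eqP; rewrite eq_le !le.
case: (dist2_val v u) => [/dist2_eq0->|[n vu]]; first exact: lexx.
by rewrite vu dist2_le eq_sym -dist2_le vu lexx.
Qed.

Lemma dist2_ultra y x z : dist2 x z <= Num.max (dist2 x y) (dist2 y z).
Proof.
wlog : x z / dist2 y z <= dist2 x y => [th|yzxy].
  have [/th//|xyyz] := boolP (dist2 y z <= dist2 x y).
  rewrite dist2C maxC (dist2C x y) (dist2C y z) th //.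
  by rewrite (dist2C y x) (dist2C z y) ltW // ltNge.
rewrite (max_idPl yzxy).
case: (dist2_val x y) => [/dist2_eq0 xy|[n xy]]; first by rewrite {1}xy.
move: (yzxy); rewrite xy !dist2_le => /eqP <-.
by rewrite -dist2_le xy lexx.
Qed.

End Metric.

(* The uniform structure, stated without real numbers so that it does not      *)
(* depend on the model R of the reals in which distances are measured.         *)
Section Uniform.

Definition Z2_ent : set_system (Z2 * Z2) :=
  filter_from setT (fun n : nat => [set xy | res xy.1 n = res xy.2 n]).

Fact Z2_ent_filter : Filter Z2_ent.
Proof.
apply: filter_from_filter => [|m n _ _]; first by exists 0%N.
exists (maxn m n) => // -[x y] xy.
have {}xy : res x (maxn m n) = res y (maxn m n) := xy.
have e k : (k <= maxn m n)%N -> res x k = res y k.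
  by move=> le; rewrite -(res_le x le) -(res_le y le) xy.
by split; apply: e; [exact: leq_maxl|exact: leq_maxr].
Qed.

Local Open Scope relation_scope.

Fact Z2_ent_diag A : Z2_ent A -> diagonal `<=` A.
Proof. by case=> n _ nA [x y] xy; apply: nA; congr res. Qed.

Fact Z2_ent_inv A : Z2_ent A -> Z2_ent A^-1.
Proof. by case=> n _ nA; exists n => // -[x y] /= xy; apply: nA. Qed.

Fact Z2_ent_split A : Z2_ent A -> exists2 B, Z2_ent B & B \; B `<=` A.
Proof.
case=> n _ nA; exists [set xy | res xy.1 n = res xy.2 n]; first by exists n.
by move=> [x z] /= [y /= xy yz]; apply: nA => /=; rewrite xy yz.
Qed.

End Uniform.

HB.instance Definition _ :=
  isUniform.Build Z2 Z2_ent_filter Z2_ent_diag Z2_ent_inv Z2_ent_split.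

Section PseudoMetric.
Variable R : realType.

Definition ball2 (x : Z2) (e : R) : set Z2 := [set y | dist2 R x y < e].

Fact ball2_center x (e : R) : 0 < e -> ball2 x e x.
Proof. by rewrite /ball2 /= dist2xx. Qed.

Fact ball2_sym x y (e : R) : ball2 x e y -> ball2 y e x.
Proof. by rewrite /ball2 /= dist2C. Qed.

Fact ball2_triangle x y z (e1 e2 : R) :
  ball2 x e1 y -> ball2 y e2 z -> ball2 x (e1 + e2) z.
Proof.
rewrite /ball2 /= => xy yz; apply: le_lt_trans (ltrD xy yz).
apply: le_trans (dist2_ultra R y x z) _.
by rewrite ge_max lerDl lerDr !norm2_ge0.
Qed.

Fact ball2_ent : entourage = entourage_ ball2.
Proof.
apply/seteqP; split=> A.
  case=> n _ nA; exists (2 ^- n); first by rewrite /= invr_gt0 exprn_gt0.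
  by move=> [x y] xy; apply: nA; apply/eqP; rewrite -(dist2_le R); exact: ltW.
case=> e /= e0 eA.
have [n ne] : exists n, 2 ^- n < e.
  exists (Num.bound e^-1).
  rewrite -[ltRHS]invrK ltf_pV2 ?posrE ?exprn_gt0 ?invr_gt0 //.
  apply: lt_trans (archi_boundP _) _; first by rewrite invr_ge0 ltW.
  by rewrite -natrX ltr_nat ltn_expl.
exists n => // -[x y] /= xy; apply: eA => /=.
by apply: le_lt_trans ne; rewrite dist2_le xy.
Qed.

HB.instance Definition _ := Uniform_isPseudoMetric.Build R Z2
  ball2_center ball2_sym ball2_triangle ball2_ent.

Fact dist2_ge0 x y : 0 <= dist2 R x y. Proof. exact: norm2_ge0. Qed.

Fact ball2E x d : ball x d = [set y | dist2 R x y < d]. Proof. by []. Qed.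

HB.instance Definition _ :=
  PseudoMetric_isMetric.Build R Z2 dist2_ge0 (@dist2_eq0 R) ball2E.

End PseudoMetric.

Fixpoint fibpoly (A : nzRingType) (m : nat) : {poly A} :=
  match m with
  | 0 => 0
  | 1 => 1
  | (k.+1 as m').+1 => 'X * fibpoly A m' + fibpoly A k
  end.

Section Dynamics.
Variables (R : realType) (f : {poly Z2}).

Definition orbit2 (x : Z2) : set Z2 := [set iter n (horner f) x | n in setT].

Definition periodic_point (x : Z2) : Prop :=
  exists2 n, (0 < n)%N & iter n (horner f) x = x.

Definition periodic_orbit (C : set Z2) : Prop :=
  exists2 x, periodic_point x & C = orbit2 x.

Definition finite_union_of_balls (C : set Z2) : Prop :=
  exists2 s : seq (Z2 * R), (forall c, c \in s -> 0 < c.2) &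
    C = \bigcup_(c in [set` s]) ball c.1 c.2.

Definition minimal_component (C : set Z2) : Prop :=
  [/\ clopen C, C !=set0, finite_union_of_balls C,
      (forall x, C x -> C f.[x])
    & forall x, C x -> C `<=` closure (orbit2 x)].

Definition attracted (C : set Z2) (x : Z2) : Prop :=
  (fun n => @edist_inf R Z2 C (iter n (horner f) x)) @ \oo --> 0%E.

Record minimal_decomposition
    (P : set Z2) (I : Type) (M : I -> set Z2) (B : set Z2) : Prop := {
  md_cover : P `|` \bigcup_i M i `|` B = setT;
  md_disjPM : P `&` \bigcup_i M i = set0;
  md_disjPB : P `&` B = set0;
  md_disjMB : \bigcup_i M i `&` B = set0;
  md_finite : finite_set P;
  md_periodic : P = [set x | periodic_point x];
  md_countable : countable [set: I];
  md_disjM : trivIset setT M;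
  md_components : range M = [set C | minimal_component C];
  md_basin : forall x, B x -> exists2 C,
    periodic_orbit C \/ minimal_component C & attracted C x
}.

End Dynamics.

(* a + 2^n Z_2 *)
Definition coset2 (a n : nat) : set Z2 := [set a%:R + 2 ^+ n * y | y in setT].

Definition M_ (k : 'I_4) : set Z2 :=
  coset2 (1 + 4 * k)%N 4 `|` coset2 (11 + 4 * k)%N 4.

(* Main.v *)
Require Import Defs.
From mathcomp Require Import all_boot all_order all_algebra.
From mathcomp Require Import all_classical all_reals all_analysis.
From mathcomp Require Import ring zify.

(** Write f for the Fibonacci polynomial of index m = 16 + 24 d.

    Even points.  For even indices F_{2k}(y) = k y + O(y^2), and here k = m / 2
    is even, so f multiplies an even y by an even number: each step gains a
    power of two ([fib_even_contract]), and even points tend to the fixed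
    point 0.

    Odd points.  Modulo 16, f exchanges the two cosets 1 + 4k and 11 + 4k that
    make up M_k.  Its square g is a translation by an odd multiple of 2^4, and
    its difference quotients between points that agree modulo 4 are congruent
    to 1 modulo 4.  These two properties pass from a shift by 2^n to one by
    2^(n+1) when g is composed with itself ([odd_shift_comp]): if
    g x = x + h with h = 2^n (odd), then
      g (g x) - x = (g (g x) - g x) + h = h (2 + 4 w) = 2^(n+1) (odd).
    So the 2^j-th iterate of g changes exactly the digit of weight 2^(4 + j)
    modulo higher digits, as in an odometer.  Digits can therefore be corrected
    one at a time, which makes every orbit in M_k dense there
    ([odd_shift_dense]), and no odd point is periodic ([odd_shift_aperiodic]).

    The two properties of g concern residues modulo 32 and modulo 4.  For odd x
    the matrix of the Fibonacci recurrence has order dividing 48 modulo 32, so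
    the residues of F_m and of its difference quotient depend only on the
    parity of d, and a finite computation settles them ([fibcheckP]).

    There is no further minimal component.  One that contains an odd point is
    the closure of the orbit of that point, which is some M_k.  One that
    contains an even point contains the limit 0 of its orbit, so it is {0} by
    minimality, and {0} is not open. *)

Import GRing.Theory Num.Theory.

Local Open Scope classical_set_scope.
Local Open Scope ring_scope.

(** * Divisibility by powers of two *)


Lemma res_eq0P (x : Z2) n : res x n = 0%N <-> exists y, x = 2 ^+ n * y.
Proof.
split=> [xn0|[y ->]]; last first.
  by rewrite resM -natrX res_natr modnn mul0n mod0n.
have dvd k : (2 ^ n %| res x (n + k))%N.
  by rewrite /dvdn res_le ?leq_addr // xn0.
have coh k : ((res x (n + k.+1) %/ 2 ^ n) %% 2 ^ k = res x (n + k) %/ 2 ^ n)%N.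
  apply/eqP; rewrite -(@eqn_pmul2r (2 ^ n)) ?expn_gt0 //.
  by rewrite muln_modl !divnK // -expnD [(k + n)%N]addnC addnS res_coh.
exists (MkZ2 coh); apply: Z2_eq => k.
rewrite resM -natrX res_natr /= modnMml mulnC divnK //.
by rewrite res_le ?leq_addl.
Qed.

Lemma res_eqP (x y : Z2) n : res x n = res y n <-> exists z, x = y + 2 ^+ n * z.
Proof.
split=> [xy|[z ->]].
  have /res_eq0P[z xyz] : res (x - y) n = 0%N by apply/eqP; rewrite resB_eq0 xy.
  by exists z; rewrite -xyz addrC subrK.
have /res_eq0P z0 : exists u, 2 ^+ n * z = 2 ^+ n * u by exists z.
by rewrite resD z0 addn0 res_mod.
Qed.

Lemma coset2E a n : coset2 a n = [set x | res x n = a %% 2 ^ n]%N.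
Proof.
apply/seteqP; split=> x /=.
  by case=> y _ <-; rewrite -res_natr; apply/res_eqP; exists y.
by rewrite -res_natr => /res_eqP[y ->]; exists y.
Qed.

Lemma res_odd (x : Z2) n : (0 < n)%N -> odd (res x n) = (res x 1 == 1%N).
Proof.
move=> n0; rewrite -(res_le x n0) expn1 modn2.
by case: (odd _).
Qed.

Lemma res_1E (x : Z2) : res x 1 = 0%N \/ res x 1 = 1%N.
Proof. by case: (res x 1) (res_lt x 1) => [|[|]] //; [left|right]. Qed.

(** * Fibonacci polynomials modulo 32 *)

Lemma fibpolySS (x : Z2) k :
  (fibpoly Z2 k.+2).[x] = x * (fibpoly Z2 k.+1).[x] + (fibpoly Z2 k).[x].
Proof. by rewrite /= -/(fibpoly Z2 k.+1) !hornerE. Qed.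

(** The difference quotient of the k-th Fibonacci polynomial between x and y,
    generated by its own recurrence, so that its residues can be computed
    without dividing by y - x. *)
Fixpoint fibslope (x y : Z2) (k : nat) : Z2 :=
  match k with
  | 0 => 0
  | k'.+1 => match k' with
    | 0 => 0
    | k''.+1 => y * fibslope x y k' + (fibpoly Z2 k').[x] + fibslope x y k''
    end
  end.

Lemma fibslopeSS (x y : Z2) k : fibslope x y k.+2 =
  y * fibslope x y k.+1 + (fibpoly Z2 k.+1).[x] + fibslope x y k.
Proof. by []. Qed.

Lemma fibslopeP (x y : Z2) k :
  (fibpoly Z2 k).[y] - (fibpoly Z2 k).[x] = (y - x) * fibslope x y k.
Proof.
suff: (fibpoly Z2 k).[y] - (fibpoly Z2 k).[x] = (y - x) * fibslope x y k /\
  (fibpoly Z2 k.+1).[y] - (fibpoly Z2 k.+1).[x] = (y - x) * fibslope x y k.+1.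
  by case.
elim: k => [|k [IH0 IH1]]; first by rewrite /= !hornerE subrr oppr0.
split=> //; rewrite !fibpolySS fibslopeSS.
rewrite -(subrK (fibpoly Z2 k.+1).[x] (fibpoly Z2 k.+1).[y]) IH1.
rewrite -(subrK (fibpoly Z2 k).[x] (fibpoly Z2 k).[y]) IH0.
ring.
Qed.

(** One step of the recurrences for two consecutive values modulo 32 (first
    pair) and two consecutive difference quotients modulo 4 (second pair), at a
    point with residue r modulo 32. *)
Definition fibstep (r : nat) (s : (nat * nat) * (nat * nat)) :=
  let: ((a, b), (c, e)) := s in
  ((b, (r * b + a) %% 32), (e, (r * e + b + c) %% 4))%N.

Definition fibstate (r k : nat) := iter k (fibstep r) ((0, 1), (0, 0))%N.

(** When x and y agree modulo 4, the residue of the difference quotient depends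
    on x alone, since y enters its recurrence only as a coefficient. *)
Lemma fibstateE (x y : Z2) k : res x 2 = res y 2 -> fibstate (res x 5) k =
  ((res (fibpoly Z2 k).[x] 5, res (fibpoly Z2 k.+1).[x] 5),
   (res (fibslope x y k) 2, res (fibslope x y k.+1) 2)).
Proof.
move=> xy; elim: k => [|k IHk].
  by rewrite /fibstate [fibpoly _ _]/= [fibpoly _ 1]/= !hornerE ![fibslope _ _ _]/=.
rewrite /fibstate iterS -/(fibstate _ k) IHk /fibstep fibpolySS fibslopeSS.
congr ((_, _), (_, _)).
  by rewrite resD resM modnDml.
rewrite !resD resM -xy -(@res_le x 2 5) // -(@res_le (fibpoly _ _).[x] 2 5) //.
rewrite -[(2 ^ 2)%N]/4%N.
by rewrite modnDm modnDml -!addnA -[RHS]modnDml modnMml modnDml.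
Qed.

(** The companion matrix of the recurrence at an odd point has order 3 modulo 2,
    hence order dividing 3 * 2^4 modulo 32; by computation the difference
    quotients modulo 4 return after the same 48 steps. *)
Lemma fibstate_period r k : (r < 32)%N -> odd r ->
  fibstate r (k + 48) = fibstate r k.
Proof.
move=> r32 r_odd; rewrite /fibstate iterD; congr iter; apply/eqP.
have: all (fun i => iter 48 (fibstep i) ((0, 1), (0, 0)) == ((0, 1), (0, 0)))%N
        [seq i <- iota 0 32 | odd i] by vm_compute.
by move/allP; apply; rewrite mem_filter r_odd mem_iota.
Qed.

Lemma fibstate_parity r d : (r < 32)%N -> odd r ->
  fibstate r (16 + 24 * d) = fibstate r (16 + 24 * odd d).
Proof.
move=> r32 r_odd; rewrite -[X in (24 * X)%N](odd_double_half d).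
elim: (d./2) => [|h <-]; first by rewrite addn0.
by rewrite -[RHS]fibstate_period //; congr fibstate; lia.
Qed.

(** What the dynamics at odd points requires of residues: s describes F_k at r,
    and t describes it at the image of r.  The last conjunct is the chain rule
    for the difference quotient of the second iterate. *)
Definition fibcheck (k r : nat) : bool :=
  let s := fibstate r k in let t := fibstate s.1.1 k in
  [&& (s.1.1 < 32)%N, odd s.1.1,
      s.1.1 %% 16 == (r + (if r %% 4 == 1 then 10 else 6)) %% 16,
      t.1.1 == (r + 16) %% 32 & (s.2.1 * t.2.1) %% 4 == 1]%N.

Lemma fibcheckP d r : (r < 32)%N -> odd r -> fibcheck (16 + 24 * d) r.
Proof.
move=> r32 r_odd.
have: fibcheck (16 + 24 * odd d) r.
  have: all (fun b : bool => all (fibcheck (16 + 24 * b))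
          [seq i <- iota 0 32 | odd i]) [:: false; true] by vm_compute.
  move=> /allP/(_ (odd d)); rewrite !inE; case: (odd d) => /(_ isT) /allP;
  by apply; rewrite mem_filter r_odd mem_iota.
rewrite /fibcheck => /and5P[s32 s_odd]; rewrite (fibstate_parity r d) //.
by rewrite (fibstate_parity _ d s32 s_odd) s32 s_odd => -> -> ->.
Qed.

(** * Values and difference quotients at odd points *)

Lemma res_eq_le (x y : Z2) m n : (m <= n)%N -> res x n = res y n ->
  res x m = res y m.
Proof. by move=> mn xy; rewrite -(res_le x mn) xy res_le. Qed.

(** The residues of [fibcheck] turned into exact statements in Z_2.  The slope of
    the second iterate is the product of the slopes at x and at f x, and the
    latter is computable because f preserves congruence modulo 4. *)
Lemma fib_odd_facts d (x : Z2) (f := horner (fibpoly Z2 (16 + 24 * d))) :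
  res x 1 = 1%N ->
  [/\ res (f x) 1 = 1%N,
      res (f x) 4 = ((res x 4 + (if res x 2 == 1 then 10 else 6)) %% 16)%N,
      exists u, f (f x) = x + 2 ^+ 4 * (1 + 2 * u) &
      forall y, res x 2 = res y 2 -> exists w,
        f (f y) - f (f x) = (y - x) * (1 + 4 * w)].
Proof.
move=> x_odd; have r_odd : odd (res x 5) by rewrite res_odd // x_odd.
have r32 : (res x 5 < 32)%N by exact: res_lt.
have := fibcheckP d _ r32 r_odd; set k := (16 + 24 * d)%N in f *.
have stE y z : res z 2 = res y 2 -> res (f y) 5 = (fibstate (res y 5) k).1.1
    /\ res (fibslope y z k) 2 = (fibstate (res y 5) k).2.1.
  by move=> yz; rewrite (fibstateE y z k (esym yz)).
have [fx _] := stE x x erefl; have [ffx _] := stE (f x) (f x) erefl.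
rewrite /fibcheck -fx -ffx => /and5P[_ fx_odd /eqP fx4 /eqP ffx5 /eqP slope].
split.
- by apply/eqP; rewrite -(@res_odd _ 5).
- by rewrite -(@res_le (f x) 4 5) // fx4 -modnDml -(@res_le x 4 5) // -(@res_le x 2 5) //; rewrite modnDml.
- have /res_eqP[z ->] : res (f (f x)) 5 = res (x + 16%:R) 5.
    by rewrite resD res_natr ffx5.
  by exists z; ring.
- move=> y yx.
  have fyx : res (f x) 2 = res (f y) 2.
    have /res_eqP[z yxz] := esym yx; apply/esym/res_eqP; exists (z * fibslope x y k).
    by rewrite -[LHS](subrK (f x)) fibslopeP {1}yxz; ring.
  have [_ s1] := stE x y (esym yx); have [_ s2] := stE (f x) (f y) (esym fyx).
  have /res_eqP[w sw] : res (fibslope x y k * fibslope (f x) (f y) k) 2 = res (1 : Z2) 2.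
    by rewrite resM s1 s2 slope.
  exists w; rewrite /f !fibslopeP -mulrA sw; congr (_ * (_ + _)); ring.
Qed.

(** * Odometer dynamics on odd 2-adic integers *)

Lemma Z2_parity (x : Z2) :
  (exists y, x = 2 * y) \/ (res x 1 = 1%N /\ exists y, x = 1 + 2 * y).
Proof.
have [/res_eq0P[y ->]|x1] := res_1E x; first by left; exists y; rewrite expr1.
right; split=> //; have /res_eqP[y ->] : res x 1 = res (1 : Z2) 1 by [].
by exists y; rewrite expr1.
Qed.

Definition odd_shift (n : nat) (g : Z2 -> Z2) : Prop :=
  forall x, res x 1 = 1%N -> exists u, g x = x + 2 ^+ n * (1 + 2 * u).

Definition slope_1mod4 (g : Z2 -> Z2) : Prop :=
  forall x y, res x 1 = 1%N -> res x 2 = res y 2 ->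
    exists w, g y - g x = (y - x) * (1 + 4 * w).

Lemma odd_shift_res n g x m : odd_shift n g -> res x 1 = 1%N -> (m <= n)%N ->
  res (g x) m = res x m.
Proof.
move=> gS x1 mn; apply: (res_eq_le _ _ _ _ mn); apply/res_eqP.
by have [u ->] := gS x x1; exists (1 + 2 * u).
Qed.

(** The second displacement is the first one times a number 1 + 4 w, so they
    add up to the first one times 2 (1 + 2 w): the shift gains exactly one power
    of two.  Slopes multiply, and stay congruent to 1 modulo 4. *)
Lemma odd_shift_comp n g : (2 <= n)%N -> odd_shift n g -> slope_1mod4 g ->
  odd_shift n.+1 (g \o g) /\ slope_1mod4 (g \o g).
Proof.
move=> n2 gS gI; split=> [x x1|x y x1 xy] /=.
  have [u gx] := gS x x1.
  (* the slope between x and its own image compares the two displacements *)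
  have [|w] := gI x (g x) x1; first by rewrite (odd_shift_res n).
  rewrite {3}gx => ggx; exists (u + w + 2 * u * w).
  by rewrite -[LHS](subrK (g x)) ggx gx exprS; ring.
have y1 : res y 1 = 1%N by rewrite -(res_eq_le x y 1 2).
have gx1 : res (g x) 1 = 1%N by rewrite (odd_shift_res n) // ltnW.
have [w gxy] := gI x y x1 xy.
have [|w' ->] := gI (g x) (g y) gx1; first by rewrite !(odd_shift_res n).
by exists (w + w' + 4 * w * w'); rewrite gxy; ring.
Qed.

Lemma odd_shift_iter_expn n g j : (2 <= n)%N -> odd_shift n g -> slope_1mod4 g ->
  odd_shift (n + j) (iter (2 ^ j) g) /\ slope_1mod4 (iter (2 ^ j) g).
Proof.
move=> n2 gS gI; elim: j => [|j [IHS IHI]]; first by rewrite addn0.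
have -> : iter (2 ^ j.+1) g = iter (2 ^ j) g \o iter (2 ^ j) g.
  by apply/funext => x; rewrite /= -iterD addnn -mul2n -expnS.
by rewrite addnS; apply: odd_shift_comp => //; rewrite (leq_trans n2) ?leq_addr.
Qed.

(** The orbit of x approximates y digit by digit: if an iterate of x agrees with
    y modulo 2^(n+j) but not modulo 2^(n+j+1), then 2^j more steps flip the
    wrong digit and leave the lower ones unchanged. *)
Lemma odd_shift_dense n g x y : (2 <= n)%N -> odd_shift n g -> slope_1mod4 g ->
  res x 1 = 1%N -> res x n = res y n ->
  forall j, exists i, res (iter i g x) (n + j) = res y (n + j).
Proof.
move=> n2 gS gI x1 xy; elim=> [|j [i]]; first by exists 0%N; rewrite addn0.
have zodd k : res (iter k g x) 1 = 1%N.
  by elim: k => //= k IHk; rewrite (odd_shift_res n) // ltnW.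
case/res_eqP => t zt; have [[t' tE]|[_ [t' tE]]] := Z2_parity t.
  by exists i; apply/res_eqP; exists t'; rewrite zt tE addnS exprS; ring.
have [/(_ _ (zodd i))[u gz] _] := odd_shift_iter_expn n g j n2 gS gI.
exists (2 ^ j + i)%N; apply/res_eqP; exists (1 + t' + u).
by rewrite iterD gz zt tE addnS exprS; ring.
Qed.

Lemma odd_shift_iter n g x k : (0 < n)%N -> odd_shift n g -> res x 1 = 1%N ->
  exists u, iter k g x = x + 2 ^+ n * (k%:R + 2 * u).
Proof.
move=> n0 gS x1; elim: k => [|k [u IHk]]; first by exists 0; rewrite /=; ring.
have [|v gv] := gS (iter k g x).
  by elim: (k) => //= i IHi; rewrite (odd_shift_res n).
by exists (u + v); rewrite /= gv IHk -natr1; ring.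
Qed.

Lemma iter_comp2 (g : Z2 -> Z2) x k : iter k (g \o g) x = iter k.*2 g x.
Proof. by elim: k => // k IHk; rewrite doubleS /= IHk. Qed.

(** An odd number of steps displaces x by an odd multiple of 2^n, which is not
    zero; an even number of steps is half as many steps of the square of g,
    a shift by 2^(n+1). *)
Lemma odd_shift_aperiodic n g x k : (2 <= n)%N -> odd_shift n g ->
  slope_1mod4 g -> res x 1 = 1%N -> (0 < k)%N -> iter k g x <> x.
Proof.
elim/ltn_ind: k n g => k IHk n g n2 gS gI x1 k0 gkx.
have kE := odd_double_half k; case k_odd: (odd k) in kE.
  rewrite /= in kE; have [u] := odd_shift_iter n g x k (ltnW n2) gS x1.
  rewrite gkx -kE -[LHS]addr0 => /addrI /esym.
  have -> : (1 + k./2.*2)%:R + 2 * u = 1 + 2 * (k./2%:R + u) :> Z2.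
    by rewrite -mul2n natrD natrM; ring.
  rewrite mulrDr mulr1 mulrA -exprSr => /(congr1 (fun z => res z n.+1)).
  have /res_eq0P z0 : exists v, 2 ^+ n.+1 * (k./2%:R + u) = 2 ^+ n.+1 * v.
    by exists (k./2%:R + u).
  rewrite resD z0 addn0 res_mod res0 -natrX res_natr modn_small ?ltn_exp2l //.
  by apply/eqP; rewrite -lt0n expn_gt0.
have [g2S g2I] := odd_shift_comp n g n2 gS gI.
apply: (IHk k./2 _ n.+1 (g \o g)) => //; [lia | exact: leqW | lia |].
by move: gkx; rewrite iter_comp2 -{1}kE.
Qed.

(** * Topology of the 2-adic integers through residues *)

Lemma Z2_nbhsP (x : Z2) (A : set Z2) :
  nbhs x A <-> exists n, forall y, res y n = res x n -> A y.
Proof.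
rewrite -nbhs_entourageE; split=> [[B [n _ nB] BA]|[n nA]].
  by exists n => y yx; apply: BA; rewrite /xsection /= inE; apply: nB => /=.
exists [set xy | res xy.1 n = res xy.2 n]; first by exists n.
by move=> y; rewrite /xsection /= inE /= => xy; apply: nA.
Qed.

Lemma closure_resP (A : set Z2) y :
  closure A y <-> forall n, exists2 x, A x & res x n = res y n.
Proof.
split=> [Ay n|Ay B /Z2_nbhsP[n nB]].
  have [|x [Ax xy]] := Ay [set x | res x n = res y n]; last by exists x.
  by apply/Z2_nbhsP; exists n.
by have [x Ax xy] := Ay n; exists x; split=> //; apply: nB.
Qed.

Lemma res_open n (P : pred nat) : open [set x : Z2 | P (res x n)].
Proof.
by rewrite openE => x /= Px; apply/Z2_nbhsP; exists n => y /= ->.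
Qed.

Lemma res_clopen n (P : pred nat) : clopen [set x : Z2 | P (res x n)].
Proof.
split; first exact: res_open.
rewrite -[X in closed X]setCK closedC.
suff -> : ~` [set x : Z2 | P (res x n)] = [set x | ~~ P (res x n)].
  exact: (res_open n (fun r => ~~ P r)).
by apply/seteqP; split=> x /= /negP.
Qed.

(** Distances are powers of two, so a strict bound by one power is a weak bound
    by the next one. *)
Lemma dist2_lt (R : realType) (x y : Z2) n :
  (dist2 R x y < 2 ^- n) = (res x n.+1 == res y n.+1).
Proof.
rewrite -(dist2_le R); apply/idP/idP => [|le_xy]; last first.
  apply: (Order.POrderTheory.le_lt_trans le_xy).
  by rewrite ltf_pV2 ?posrE ?exprn_gt0 // ltr_eXn2l ?ltr1n.
have [->|[k ->]] := dist2_val R x y; first by rewrite invr_ge0 exprn_ge0.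
rewrite ltf_pV2 ?posrE ?exprn_gt0 // ltr_eXn2l ?ltr1n // => nk.
by rewrite lef_pV2 ?posrE ?exprn_gt0 // ler_eXn2l ?ltr1n.
Qed.

Lemma ball_coset2 (R : realType) (a n : nat) :
  ball (a%:R : Z2) (2 ^- n : R) = coset2 a n.+1.
Proof.
rewrite coset2E ball2E; apply/seteqP; split=> x /=; rewrite dist2_lt res_natr.
  by move/eqP.
by move=> ->.
Qed.

(** The distance to a set is a continuous function, and it vanishes at a. *)
Lemma attracted_set1 (R : realType) (p : {poly Z2}) (a x : Z2) :
  (forall n, exists N, forall k, (N <= k)%N -> res (iter k (horner p) x) n = res a n) ->
  attracted R p [set a] x.
Proof.
move=> x_a; have cvg_xa : iter n (horner p) x @[n --> \oo] --> a.
  move=> A /Z2_nbhsP[n nA]; have [N xN] := x_a n.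
  by exists N => // k /= Nk; apply/nA/xN.
rewrite /attracted -(@edist_inf0 R Z2 [set a] a) //.
exact: continuous_cvg (@edist_inf_continuous R Z2 [set a] a) cvg_xa.
Qed.

(** * Attraction of even points to 0 *)

(** The expansion at 0 to first order: F_{2k} has linear coefficient k.  The
    induction also uses that F_{2k+1} has constant term 1. *)
Lemma fibpoly_even_taylor (y : Z2) k :
  exists w, (fibpoly Z2 k.*2).[y] = y * (k%:R + y * w).
Proof.
suff: exists w v, (fibpoly Z2 k.*2).[y] = y * (k%:R + y * w) /\
    (fibpoly Z2 k.*2.+1).[y] = 1 + y * v by move=> [w [v [? _]]]; exists w.
elim: k => [|k [w [v [F0 F1]]]].
  by exists 0, 0; rewrite mulr0n !(mulr0, addr0) /= horner0 hornerC.
have F2 : (fibpoly Z2 k.+1.*2).[y] = y * (k.+1%:R + y * (v + w)).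
  by rewrite doubleS fibpolySS F1 F0 -natr1; ring.
exists (v + w), (v + y * (k.+1%:R + y * (v + w))); split=> //.
by rewrite doubleS fibpolySS -doubleS F2 F1; ring.
Qed.

(** The linear coefficient m / 2 = 8 + 12 d is even, so f y is an even multiple
    of y. *)
Lemma fib_even_contract d (y : Z2) n : res y n.+1 = 0%N ->
  res (fibpoly Z2 (16 + 24 * d)).[y] n.+2 = 0%N.
Proof.
move=> /res_eq0P[z yz]; have -> : (16 + 24 * d = (8 + 12 * d).*2)%N by lia.
have [w ->] := fibpoly_even_taylor y (8 + 12 * d).
apply/res_eq0P; exists (z * ((4 + 6 * d)%:R + 2 ^+ n * z * w)).
have -> : (8 + 12 * d = 2 * (4 + 6 * d))%N by lia.
by rewrite yz natrM !exprS; ring.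
Qed.

Lemma fib_even_iter d (x : Z2) k : res x 1 = 0%N ->
  res (iter k (horner (fibpoly Z2 (16 + 24 * d))) x) k.+1 = 0%N.
Proof. by move=> x0; elim: k => //= k; exact: fib_even_contract. Qed.

Lemma fib_attracted (R : realType) d (x : Z2) : res x 1 = 0%N ->
  attracted R (fibpoly Z2 (16 + 24 * d)) [set 0] x.
Proof.
move=> x0; apply: attracted_set1 => n; exists n => k nk.
by apply: (res_eq_le _ _ n k.+1); [exact: leqW | rewrite fib_even_iter // res0].
Qed.

(** * The sets M_k *)

Definition M_res (k r : nat) : bool :=
  ((r == (1 + 4 * k) %% 16) || (r == (11 + 4 * k) %% 16))%N.

Lemma M_E (k : 'I_4) : M_ k = [set x | M_res k (res x 4)].
Proof.
rewrite /M_ !coset2E; apply/seteqP; split=> x /=.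
  by case=> ->; rewrite /M_res eqxx ?orbT.
by case/orP => /eqP; [left|right].
Qed.

Lemma M_odd k (x : Z2) : M_ k x -> res x 1 = 1%N.
Proof.
rewrite M_E /= => Mx; apply/eqP; rewrite -(res_odd x 4) //.
by case/orP: Mx => /eqP->; lia.
Qed.

Lemma odd_M (x : Z2) : res x 1 = 1%N -> exists k, M_ k x.
Proof.
move=> x1; have r_odd : odd (res x 4) by rewrite res_odd // x1.
have r16 : (res x 4 < 16)%N by exact: res_lt.
have [k k4 Mk] : exists2 k, (k < 4)%N & M_res k (res x 4).
  (* residues 1 mod 4 are of the form 1 + 4k; the others, 3 mod 4, are 11 + 4k,
     and 11 = -5 modulo 16 *)
  rewrite /M_res; have [r1|r3] := eqVneq (res x 4 %% 4)%N 1%N.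
    by exists (res x 4 %/ 4)%N; lia.
  by exists (((res x 4 + 5) %/ 4) %% 4)%N; lia.
by exists (Ordinal k4); rewrite M_E.
Qed.

Lemma M_inj k l (x : Z2) : M_ k x -> M_ l x -> k = l.
Proof.
rewrite !M_E /= /M_res => Mk Ml; apply/val_inj => /=.
have := ltn_ord k; have := ltn_ord l; lia.
Qed.

(** * Dynamics on the sets M_k *)

Section Components.
Variable d : nat.
Let f := horner (fibpoly Z2 (16 + 24 * d)).

(** f exchanges the two cosets modulo 16 that form M_k, so any point of M_k is
    congruent to x or to f x. *)
Lemma M_swap k (x : Z2) : M_ k x -> forall y, M_ k y ->
  res y 4 = res x 4 \/ res y 4 = res (f x) 4.
Proof.
move=> Mx y; have [_ -> _ _] := fib_odd_facts d x (M_odd _ _ Mx).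
move: Mx; rewrite -(@res_le x 2 4) // !M_E /= /M_res => Mx My.
by have := ltn_ord k; case: ifP; lia.
Qed.

Lemma M_stable k (x : Z2) : M_ k x -> M_ k (f x).
Proof.
move=> Mx; rewrite M_E /=; have [_ -> _ _] := fib_odd_facts d x (M_odd _ _ Mx).
move: Mx; rewrite -(@res_le x 2 4) // !M_E /= /M_res => Mx.
by have := ltn_ord k; case: ifP; lia.
Qed.

Lemma fib_sq_odd_shift : odd_shift 4 (f \o f) /\ slope_1mod4 (f \o f).
Proof.
by split=> [x x1|x y x1 xy]; have [_ _ ? slope] := fib_odd_facts d x x1 => //; exact: slope.
Qed.

(** The square of f is a shift on each of the two cosets of M_k, and one step of
    f leads from one coset to the other. *)
Lemma M_transitive k (x y : Z2) n : M_ k x -> M_ k y ->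
  exists i, res (iter i f x) n = res y n.
Proof.
move=> Mx My; have [gS gI] := fib_sq_odd_shift.
have dense z : M_ k z -> res y 4 = res z 4 ->
    exists i, res (iter i f z) n = res y n.
  move=> Mz yz; have [||i] := odd_shift_dense 4 _ z y _ gS gI (M_odd _ _ Mz) _ n => //.
  rewrite iter_comp2 => zy; exists i.*2; apply: res_eq_le zy; exact: leq_addl.
have [/dense|/dense] := M_swap _ _ Mx y My; first exact.
by case=> [|i]; [exact: M_stable | rewrite -iterSr; exists i.+1].
Qed.

Lemma closure_orbit_M k (x : Z2) : M_ k x ->
  M_ k `<=` closure (orbit2 (fibpoly Z2 (16 + 24 * d)) x).
Proof.
move=> Mx y My; apply/closure_resP => n; have [i xy] := M_transitive k x y n Mx My.
by exists (iter i f x) => //; exists i.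
Qed.

Lemma fib0 : f 0 = 0.
Proof.
rewrite /f; have -> : (16 + 24 * d = (8 + 12 * d).*2)%N by lia.
by have [w ->] := fibpoly_even_taylor 0 (8 + 12 * d); rewrite mul0r.
Qed.

(** A point of period n is also of period k n; for an even x, k n steps make it
    divisible by 2^(k n + 1), for every k. *)
Lemma fib_periodicP (x : Z2) :
  periodic_point (fibpoly Z2 (16 + 24 * d)) x <-> x = 0.
Proof.
split=> [[n n0 fx]|->]; last by exists 1%N => //=; exact: fib0.
have [x0|x1] := res_1E x.
  have fkx k : iter (k * n) f x = x.
    by elim: k => // k IHk; rewrite mulSn iterD IHk.
  apply: Z2_eq => k; rewrite -(fkx k) -(res_le _ (leqW (leq_pmulr k n0))).
  by rewrite fib_even_iter // mod0n res0.
have [gS gI] := fib_sq_odd_shift.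
case: (odd_shift_aperiodic 4 _ x n isT gS gI x1 n0).
by rewrite iter_comp2 -addnn iterD fx fx.
Qed.

(** The balls have radius 2^-3, not 2^-4, because a ball is defined by a strict
    inequality. *)
Lemma M_finite_union_of_balls (R : realType) k : finite_union_of_balls R (M_ k).
Proof.
exists [:: ((1 + 4 * k)%:R, 2 ^- 3); ((11 + 4 * k)%:R, 2 ^- 3)].
  by move=> c; rewrite !inE => /orP[]/eqP-> /=; rewrite invr_gt0 exprn_gt0.
rewrite /M_ -!(ball_coset2 R); apply/seteqP; split=> x.
  by case=> xB; [exists ((1 + 4 * k)%:R, 2 ^- 3)|exists ((11 + 4 * k)%:R, 2 ^- 3)];
    rewrite //= !inE eqxx ?orbT.
by case=> c /=; rewrite !inE => /orP[]/eqP-> /= xB; [left|right].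
Qed.

Lemma M_minimal (R : realType) k :
  minimal_component R (fibpoly Z2 (16 + 24 * d)) (M_ k).
Proof.
split.
- by rewrite M_E; exact: (res_clopen 4 (M_res k)).
- by exists (1 + 4 * k)%:R; rewrite M_E /= res_natr /M_res eqxx.
- exact: M_finite_union_of_balls.
- exact: M_stable.
- exact: closure_orbit_M.
Qed.

Lemma stable_orbit (C : set Z2) (x : Z2) : (forall y, C y -> C (f y)) -> C x ->
  orbit2 (fibpoly Z2 (16 + 24 * d)) x `<=` C.
Proof. by move=> Cf Cx _ [n _ <-]; elim: n => //= n; exact: Cf. Qed.

Lemma stable_closed_orbit (C : set Z2) (x : Z2) : closed C ->
  (forall y, C y -> C (f y)) -> C x ->
  closure (orbit2 (fibpoly Z2 (16 + 24 * d)) x) `<=` C.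
Proof.
move=> Ccl Cf Cx; rewrite [X in _ `<=` X](closure_id C).1 //.
by apply: closureS; exact: stable_orbit.
Qed.

(** A minimal component that contains an even point contains 0, the limit of its
    orbit; being open it also contains some 2^n, which is not in the closure of
    the orbit of 0.  One that contains a point of M_k is, like M_k, the closure
    of the orbit of that point. *)
Lemma minimal_is_M (R : realType) C :
  minimal_component R (fibpoly Z2 (16 + 24 * d)) C -> exists k, C = M_ k.
Proof.
case=> -[Cop Ccl] [x Cx] _ Cf Cmin; have [x0|x1] := res_1E x.
  have C0 : C 0.
    apply: (stable_closed_orbit C x) => //; apply/closure_resP => n.
    exists (iter n f x); first by exists n.
    apply: (res_eq_le _ _ n n.+1 (leqnSn n)).
    by rewrite fib_even_iter // res0.
  have orb0 : orbit2 (fibpoly Z2 (16 + 24 * d)) 0 `<=` [set 0].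
    by apply: stable_orbit => // y ->; exact: fib0.
  move: (Cop); rewrite openE => /(_ _ C0) /Z2_nbhsP[n nC].
  have /(Cmin _ C0) /closure_resP/(_ n.+1)[z /orb0->] : C (2 ^+ n).
    by apply: nC; rewrite -natrX res_natr modnn res0.
  rewrite res0 -natrX res_natr modn_small ?ltn_exp2l // => /esym/eqP.
  by rewrite expn_eq0.
have [k Mx] := odd_M x x1; exists k.
have [[Mop Mcl] _ _ Ms _] := M_minimal R k.
apply/seteqP; split=> y Ay.
  by apply: (stable_closed_orbit (M_ k) x Mcl Ms Mx); exact: Cmin.
by apply: (stable_closed_orbit C x Ccl Cf Cx); exact: closure_orbit_M Mx _ Ay.
Qed.

End Components.

Theorem theorem6p3 (R : realType) (d q m : nat)
    (hq : q = (1 + 2 * d)%N) (hm : m = (4 + 12 * q)%N) :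
  [/\ minimal_decomposition R (fibpoly Z2 m)
        [set 0] M_ (coset2 0 1 `\` [set 0]),
      (fibpoly Z2 m).[0] = 0
    & forall x, (coset2 0 1 `\` [set 0]) x ->
        attracted R (fibpoly Z2 m) [set 0] x].
Proof.
have {q hq hm}-> : m = (16 + 24 * d)%N by lia.
have evenE : coset2 0 1 = [set x | res x 1 = 0%N] by rewrite coset2E.
have basin x : (coset2 0 1 `\` [set 0]) x ->
    attracted R (fibpoly Z2 (16 + 24 * d)) [set 0] x.
  by rewrite evenE => -[x0 _]; exact: fib_attracted.
split; [split | exact: fib0 | exact: basin].
- rewrite evenE; apply/seteqP; split=> // x _.
  have [-> | x_neq0] := pselect (x = 0); first by left; left.
  have [x0|/odd_M[k Mx]] := res_1E x; first by right.
  by left; right; exists k.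
- by apply/seteqP; split=> // x [-> [k _ /M_odd]]; rewrite res0.
- by apply/seteqP; split=> // x [? []].
- rewrite evenE; apply/seteqP; split=> // x [[k _ /M_odd x1] [/= x0 _]].
  by rewrite x1 in x0.
- exact: finite_set1.
- by apply/seteqP; split=> x; rewrite /= fib_periodicP.
- exact: countableP.
- by move=> k l _ _ [x [Mk Ml]]; exact: M_inj Mk Ml.
- apply/seteqP; split=> C /=; first by case=> k _ <-; exact: M_minimal.
  by move=> /minimal_is_M[k ->]; exists k.
- move=> x Bx; exists [set 0]; last exact: basin.
  left; exists 0; first exact/fib_periodicP.
  apply/seteqP; split=> [_ ->|]; first by exists 0%N.
  by apply: stable_orbit => // y ->; exact: fib0.
Qed.
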